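(* Let $p$ be an odd prime. For $0\le i\le \frac{p-3}{2}$ and $0\le j\le p-1$ put $s_{ip+j}=(i+1)j \bmod p$, and let $S$ be the periodic sequence over $\mathbb{Z}_p$ with ring sequence $[s_0,s_1,\dots,s_{p(p-1)/2-1}]$. Then $S$ is an orientable sequence of order $2$ over $\mathbb{Z}_p$ of period $p(p-1)/2$, and no orientable sequence of order $2$ over $\mathbb{Z}_p$ has period greater than $p(p-1)/2$.
   Context: A ring sequence $[x_0,\dots,x_{m-1}]$ denotes the periodic sequence obtained by repeating $x_0,\dots,x_{m-1}$. For a periodic sequence $S=(s_i)$ of (least) period $m$ let $\mathbf{s}_n(i)=(s_i,\dots,s_{i+n-1})$, and for $\mathbf{u}=(u_0,\dots,u_{n-1})$ let $\mathbf{u}^R=(u_{n-1},\dots,u_0)$. $S$ is an orientable sequence of order $n$ if $\mathbf{s}_n(i)=\mathbf{s}_n(j)$ implies $i\equiv j\pmod m$, and $\mathbf{s}_n(i)\neq\mathbf{s}_n(j)^R$ for all $i,j$. *)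

(* Defs.v *)
From mathcomp Require Import all_boot all_order all_algebra.

Set Implicit Arguments.
Unset Strict Implicit.
Unset Printing Implicit Defensive.

Section Sequences.
Variable T : Type.
Implicit Types (s x : nat -> T) (m n i j k : nat).

(* For m > 0, the periodic sequence with ring sequence [x_0, ..., x_(m-1)];
   the values of x from index m on are not used. *)
Definition ring_sequence m x : nat -> T := fun k => x (k %% m).

Definition has_period s m : Prop := 0 < m /\ forall i, s (i + m) = s i.

Definition least_period s m : Prop :=
  has_period s m /\ forall k, has_period s k -> m <= k.

(* The n-tuple (s_i, ..., s_(i+n-1)). *)
Definition window n s i : seq T := mkseq (fun k => s (i + k)) n.

(* The "period" of an orientable sequence always means its least period. *)
Definition orientable n m s : Prop :=
  [/\ least_period s m,
      forall i j, window n s i = window n s j -> i = j %[mod m]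
    & forall i j, window n s i <> rev (window n s j)].

End Sequences.

(* Main.v *)
Require Import Defs.
From mathcomp Require Import all_boot all_order all_algebra.
From mathcomp Require Import zify.

(** Write the index as k = i p + j. Then s_k = (i+1) k in Z_p, and
    s_(k+1) - s_k = i + 1, also across block ends (and cyclically), because each
    block starts with 0. A window of length 2 therefore determines i by its
    difference and then j by its first entry. Two reversed windows would have
    opposite differences, which is impossible as all differences lie in
    1, ..., (p-1)/2.
    For the upper bound, the windows of an orientable sequence of order 2,
    viewed as unordered pairs, are distinct 2-subsets of the alphabet. *)

Import GRing.Theory.

Lemma window2 (T : Type) (s : nat -> T) i : window 2 s i = [:: s i; s i.+1].
Proof. by rewrite /window /mkseq /= addn0 addn1. Qed.

Lemma orientable2_leq_bin (T : finType) (m : nat) (t : nat -> T) :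
  orientable 2 m t -> m <= 'C(#|T|, 2).
Proof.
case=> _ inj_t nrev_t.
have neq_t i : t i != t i.+1.
  by apply/eqP => e; case: (nrev_t i i); rewrite window2 /rev /= -e.
pose edge (i : 'I_m) := [set t i; t i.+1].
have inj_edge : injective edge.
  move=> i j eij; apply/val_inj; rewrite /= -(modn_small (ltn_ord i)).
  rewrite -(modn_small (ltn_ord j)).
  have: (t i \in edge j) && (t i.+1 \in edge j).
    by rewrite -eij !inE !eqxx orbT.
  have := neq_t i.
  (* The endpoints of the two edges can match in four ways: a repeated endpoint contradicts [neq_t],
     the parallel match gives equal windows, the crossed match a reversed one. *)
  rewrite !inE => nti /andP[/orP[] /eqP e1 /orP[] /eqP e2].
  - by rewrite e1 e2 eqxx in nti.
  - by apply: inj_t; rewrite !window2 e1 e2.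
  - by case: (nrev_t i j); rewrite !window2 e1 e2.
  - by rewrite e1 e2 eqxx in nti.
rewrite -card_draws -[m in m <= _]card_ord -cardsT -(card_imset _ inj_edge).
apply/subset_leq_card/subsetP => _ /imsetP[i _ ->].
by rewrite inE cards2 neq_t.
Qed.

Lemma eq_Zp_nat (p a b : nat) : 1 < p ->
  (a%:R = b%:R :> 'Z_p)%R <-> a = b %[mod p].
Proof.
move=> p_gt1; rewrite -!(val_Zp_nat p_gt1).
by split=> [-> | /val_inj].
Qed.

Section BlockSequence.

Variables (p h : nat) (s : nat -> 'Z_p).
Hypotheses (p_prime : prime p) (h_gt0 : 0 < h) (hp : h.*2 < p).
Hypothesis s_def : forall i j, i < h -> j < p ->
  s (i * p + j) = (((i + 1) * j)%:R)%R.

Let m := h * p.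
Let S := ring_sequence m s.
(** Slopes are naturals in [1..h]. Since [h.*2 < p], single slopes and sums of two stay below [p],
    so congruences between them are equalities. *)
Let slope k := (k %% m %/ p).+1.

Let p_gt0 : 0 < p. Proof. exact: prime_gt0. Qed.
Let p_gt1 : 1 < p. Proof. exact: prime_gt1. Qed.
Let m_gt0 : 0 < m. Proof. by rewrite muln_gt0 h_gt0. Qed.

Let slope_leq k : slope k <= h.
Proof. by rewrite /slope ltn_divLR // ltn_mod. Qed.

(** The offset inside a block is congruent to [k %% m] mod [p], so the position in the whole ring
    can replace it. *)
Lemma block_seqE k : S k = ((slope k * (k %% m))%:R)%R.
Proof.
rewrite /S /ring_sequence {1}(divn_eq (k %% m) p) s_def ?ltn_mod ?slope_leq //.
by apply/eq_Zp_nat; rewrite // addn1 modnMmr.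
Qed.

Lemma block_seqS k : S k.+1 = (S k + (slope k)%:R)%R.
Proof.
rewrite !block_seqE -natrD -mulnSr.
have modS : k.+1 %% m = (k %% m).+1 %% m by rewrite -addn1 -modnDml addn1.
have p_m : p %| m by apply: dvdn_mull.
apply/eq_Zp_nat => //.
(* If [p] divides [(k %% m).+1], then [k.+1] starts a block, possibly by wrapping around, and both
   sides vanish mod [p]. Otherwise [k.+1] stays in the block of [k], with the same slope. *)
have [p_r | pN_r] := boolP (p %| (k %% m).+1).
  have /eqP -> : p %| slope k * (k %% m).+1 by apply: dvdn_mull.
  apply/eqP; apply: dvdn_mull.
  by rewrite modS /dvdn modn_dvdm.
have r_lt : (k %% m).+1 < m.
  rewrite ltn_neqAle ltn_mod m_gt0 andbT.
  by apply: contraNneq pN_r => ->.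
by rewrite /slope modS (modn_small r_lt) divnS // (negbTE pN_r) add0n.
Qed.

Lemma block_window_inj i j : window 2 S i = window 2 S j -> i = j %[mod m].
Proof.
rewrite !window2 => -[e1]; rewrite !block_seqS => e2.
have eslope : slope i = slope j.
  move: e2; rewrite e1 => /addrI/(eq_Zp_nat _ _ _ p_gt1).
  have := slope_leq i; have := slope_leq j => lej lei.
  by rewrite !modn_small //; lia.
have slope_unit : ((slope i)%:R : 'Z_p)%R \is a GRing.unit.
  rewrite unitZpE // prime_coprime // gtnNdvd //.
  by have := slope_leq i; lia.
have /(mulrI slope_unit)/(eq_Zp_nat _ _ _ p_gt1) er :
    ((slope i)%:R * (i %% m)%:R = (slope i)%:R * (j %% m)%:R :> 'Z_p)%R.
  by rewrite -!natrM {2}eslope -!block_seqE.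
move: eslope => [eq].
by rewrite (divn_eq (i %% m) p) (divn_eq (j %% m) p) eq er.
Qed.

Lemma block_window_nrev i j : window 2 S i <> rev (window 2 S j).
Proof.
rewrite !window2 /rev /= => -[e1]; rewrite block_seqS e1 block_seqS => /eqP.
rewrite -addrA -[X in _ == X]addr0 (inj_eq (addrI _)) -natrD => /eqP e.
have /eqP : slope j + slope i = 0 %[mod p] by apply/eq_Zp_nat.
have := slope_leq i; have := slope_leq j => lej lei.
by rewrite !modn_small //; lia.
Qed.

Lemma block_seq_orientable : orientable 2 m S.
Proof.
split; [split | exact: block_window_inj | exact: block_window_nrev].
  by split=> // i; rewrite /S /ring_sequence modnDr.
move=> k [k_gt0 perk]; apply: dvdn_leq => //.
(* Any period [k] repeats the window at 0, so injectivity of windows forces [m] to divide [k]. *)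
have /block_window_inj/eqP : window 2 S k = window 2 S 0.
  by rewrite !window2 -(perk 0) -(perk 1).
by rewrite mod0n.
Qed.

End BlockSequence.

Theorem theorem4 (p : nat) (p_prime : prime p) (p_odd : odd p)
    (s : nat -> 'Z_p)
    (s_def : forall i j : nat, i <= (p - 3) %/ 2 -> j <= p - 1 ->
      s (i * p + j) = (((i + 1) * j)%:R)%R) :
  orientable 2 (p * (p - 1) %/ 2) (ring_sequence (p * (p - 1) %/ 2) s) /\
  (forall (m : nat) (t : nat -> 'Z_p),
     orientable 2 m t -> m <= p * (p - 1) %/ 2).
Proof.
have p_gt1 := prime_gt1 p_prime.
have pE : p = (p./2).*2.+1 by rewrite -[LHS]odd_double_half p_odd.
split; last first.
  move=> m t /orientable2_leq_bin.
  by rewrite card_ord Zp_cast // bin2 -subn1 -divn2.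
have -> : p * (p - 1) %/ 2 = p./2 * p.
  by rewrite {2}pE subn1 /= -muln2 mulnA mulnK // mulnC.
apply: block_seq_orientable => //; [lia | lia |].
by move=> i j lti ltj; apply: s_def; lia.
Qed.
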